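(* Let $X$ be a real Banach space, $\Omega\subset X$ open, $A\subset\Omega$ a nonempty closed convex set, and $f\colon X\to\mathbb{R}$. Suppose that there exists an upper coexhauster $\overline{E}(x^* )$ of $f$ at a point $x^*\in A$, and let $x^*$ be a point of local maximum of $f$ on $A$. Then for any $\varepsilon>0$ and $g\in\gamma(x^*,A)$ there exists $C\in\overline{E}(x^* )$ such that $p(g)\le\varepsilon$ for all $(0,p)\in C$. Moreover, if the family $\overline{E}(x^* )$ is finite, then for any $g\in\Gamma(x^*,A)$ there exists $C\in\overline{E}(x^* )$ such that $p(g)\le0$ for all $(0,p)\in C$.
   Context: $\gamma(x,A)=\{g\in X\mid\exists\alpha>0:\ x+\alpha g\in A\}$, $\Gamma(x,A)=\operatorname{cl}\gamma(x,A)$. A nonempty family $\overline{E}(x)$ of nonempty convex bounded subsets of $\mathbb{R}\times X^*$, each compact in the product of the standard topology of $\mathbb{R}$ and the weak${}^*$ topology of $X^*$, is a (Dini) upper coexhauster of $f$ at $x$ if $\inf_{C\in\overline{E}(x)}\max_{(a,p)\in C}a=0$ and, for all $\Delta x$ in a neighbourhood of zero, $$f(x+\Delta x)-f(x)=\inf_{C\in\overline{E}(x)}\max_{(a,p)\in C}(a+p(\Delta x))+o(\Delta x,x),$$ where, for every $\Delta x\in X$, $o(\alpha\Delta x,x)/\alpha\to0$ as $\alpha\downarrow0$. *)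

(* Defs.v *)
From HB Require Import structures.
From mathcomp Require Import all_boot all_order all_algebra.
From mathcomp Require Import all_classical all_reals all_analysis.

Set Implicit Arguments.
Unset Strict Implicit.
Unset Printing Implicit Defensive.

Import Order.TTheory GRing.Theory Num.Theory.
Import numFieldNormedType.Exports.

Local Open Scope classical_set_scope.
Local Open Scope ring_scope.

Section Dual.
Context {R : realType} (X : normedModType R).

Definition dual_pred : {pred X -> R^o} :=
  fun p => `[< linear p /\ continuous p >].

Lemma dual_pred_submod : submod_closed dual_pred.
Proof.
split=> [|a p q].
  apply/asboolP; split=> [k u v|u]; first by rewrite /= scaler0 addr0.
  exact: cvg_cst.
move=> /asboolP[lp cp] /asboolP[lq cq]; apply/asboolP; split=> [k u v|u].
  rewrite -[LHS]/(a *: p (k *: u + v) + q (k *: u + v)).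
  rewrite -[RHS]/(k *: (a *: p u + q u) + (a *: p v + q v)).
  by rewrite lp lq !scalerDr !scalerA (mulrC a k) addrACA.
by apply: continuousD; [apply: continuousZl_tmp; exact: cp|exact: cq].
Qed.

HB.instance Definition _ := GRing.isSubmodClosed.Build R (X -> R^o) dual_pred
  dual_pred_submod.

Record dual := Dual { dual_fun :> X -> R^o; _ : dual_fun \in dual_pred }.

HB.instance Definition _ := [isSub for dual_fun].
HB.instance Definition _ := [Choice of dual by <:].
HB.instance Definition _ := [SubChoice_isSubLmodule of dual by <:].

(* The topology carried by [dual] is the weak* topology, that is, the one
   induced by pointwise convergence, not the one of [dual_norm]. *)
HB.instance Definition _ := Topological.copy dual
  (initial_topology (dual_fun : dual -> {ptws X -> R^o})).

Lemma dual_linear (p : dual) : linear p.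
Proof. by case: p => p /= /asboolP[]. Qed.

HB.instance Definition _ (p : dual) := GRing.isLinear.Build R X R^o *:%R p
  (dual_linear p).

Lemma dual_continuous (p : dual) : continuous p.
Proof. by case: p => p /= /asboolP[]. Qed.

Definition dual_norm (p : dual) : R :=
  sup [set `|p x| | x in [set x : X | `|x| <= 1]].

End Dual.

Section FeasibleDirections.
Context {R : realType} {X : normedModType R}.
Implicit Types (x : X) (A : set X).

Definition feasible_dir x A : set X :=
  [set g | exists2 alpha : R, 0 < alpha & A (x + alpha *: g)].

Definition closed_feasible_dir x A : set X := closure (feasible_dir x A).

Definition local_max_on (f : X -> R) A x : Prop :=
  A x /\ \forall y \near x, A y -> f y <= f x.

End FeasibleDirections.

Section Coexhauster.
Context {R : realType} {X : normedModType R}.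
Implicit Types (C : set (R^o * dual X)) (E : set (set (R^o * dual X))).

Definition dual_bounded C : Prop :=
  exists M : R, forall ap, C ap -> `|ap.1| <= M /\ dual_norm ap.2 <= M.

(* For C nonempty and weak* compact this supremum is finite and attained, i.e.
   it is the maximum of a + p(dx) over C. *)
Definition max_affine C (dx : X) : \bar R :=
  ereal_sup [set (ap.1 + ap.2 dx)%:E | ap in C].

(* Taken in the extended reals, so that a family unbounded from below has
   infimum -oo instead of a default real value. *)
Definition inf_max_affine E (dx : X) : \bar R :=
  ereal_inf [set max_affine C dx | C in E].

Record upper_coexhauster (f : X -> R) (x : X) E : Prop := UpperCoexhauster {
  coexh_neq0 : E !=set0 ;
  coexh_mem : forall C, E C ->
    [/\ C !=set0, convex_set C, dual_bounded C & compact C] ;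
  coexh_inf_max : ereal_inf
    [set ereal_sup [set (ap.1 : R)%:E | ap in C] | C in E] = 0%E ;
  coexh_expansion : exists o : X -> R,
    (\forall dx \near (0 : X),
      (f (x + dx) - f x)%:E = (inf_max_affine E dx + (o dx)%:E)%E) /\
    (forall dx : X, o (alpha *: dx) / alpha @[alpha --> (0 : R)^'+] --> (0 : R))
}.

End Coexhauster.

(* Main.v *)
(** If [x + alpha g] lies in [A] for all small [alpha > 0], local maximality
    makes the increment of [f] there nonpositive, so the expansion bounds the
    infimum over [C] of the maxima of [a + alpha p(g)] by [o(alpha)]; some [C]
    then has maximum below [alpha eps], and its points with [a = 0] satisfy
    [p(g) <= eps].  For a finite family, if each [C] contained some [(0, p)]
    with [p(g) > 0], then a single [eps > 0] would satisfy [p(h) > eps] for all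
    these functionals and all [h] near [g], contradicting the first part at a
    feasible direction [h]. *)
Require Import Defs.
From HB Require Import structures.
From mathcomp Require Import all_boot all_order all_algebra.
From mathcomp Require Import all_classical all_reals all_analysis.
From mathcomp Require Import lra.

Import Order.TTheory GRing.Theory Num.Theory.
Import numFieldNormedType.Exports.

Local Open Scope classical_set_scope.
Local Open Scope ring_scope.

(** Finiteness of the coexhauster enters only here: a filter is stable under finite
    intersections. *)
Lemma near_finite_forall (T : Type) (I : choiceType) (F : set_system T)
    (D : set I) (P : I -> T -> Prop) :
  Filter F -> finite_set D -> (forall i, D i -> \forall t \near F, P i t) ->
  \forall t \near F, forall i, D i -> P i t.
Proof.
move=> FF /finite_fsetP[B ->] FP.
by have := @filter_bigI T I B P F FF FP; apply: filterS => t Pt i; exact: Pt.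
Qed.

Lemma cvg_scale_right0 (R : realType) (X : normedModType R) (g : X) :
  alpha *: g @[alpha --> (0 : R)^'+] --> (0 : X).
Proof.
rewrite -[X in _ --> X](scale0r g); apply: cvg_at_right_filter.
exact: scalel_continuous.
Qed.

(** If [x + b *: g] lies in [A] and [0 < a <= b], then [x + a *: g] is its convex combination with
    [x], of weight [a / b]. *)
Lemma feasible_dir_near (R : realType) (X : normedModType R) (A : set X)
    (x g : X) :
  convex_set A -> A x -> feasible_dir x A g ->
  \forall alpha \near (0 : R)^'+, A (x + alpha *: g).
Proof.
move=> cA Ax [b b0 Ab]; near=> a.
have a0 : 0 < a by [].
have ab : a <= b by near: a; exact: nbhs_right_le.
have ab0 : 0 <= a / b by rewrite divr_ge0 ?ltW.
have ab1 : a / b <= 1 by rewrite ler_pdivrMr// mul1r.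
have conv_xg : (a / b) *: (x + b *: g) + (1 - a / b) *: x = x + a *: g.
  by rewrite scalerDr scalerA divfK ?gt_eqF// addrAC -scalerDl subrKC scale1r.
have := cA (x + b *: g) x (Itv01 ab0 ab1).
by rewrite !inE -conv_xg; apply.
Unshelve. all: by end_near. Qed.

Lemma upper_coexhauster_feasible_dir (R : realType) (X : normedModType R)
    (A : set X) (f : X -> R) (x : X) (E : set (set (R^o * dual X)))
    (eps : R) (g : X) :
  convex_set A -> upper_coexhauster f x E -> local_max_on f A x ->
  0 < eps -> feasible_dir x A g ->
  exists2 C, E C & forall p : dual X, C (0, p) -> p g <= eps.
Proof.
move=> cA [_ _ _ [rest [fE rest0]]] [Ax fmax] eps0 gA.
have cvg0 := @cvg_scale_right0 R X g.
(* The claim does not depend on [a]; stating it for all small [a > 0] gathers the smallness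
   conditions, and any one such [a] then yields it. *)
have : \forall a \near (0 : R)^'+, exists2 C, E C &
    forall p : dual X, C (0, p) -> p g <= eps.
  near=> a.
  have a0 : 0 < a by [].
  have Aa : A (x + a *: g) by near: a; exact: feasible_dir_near.
  have fa : f (x + a *: g) <= f x.
    by move: Aa; near: a; exact: cvg0 ((nbhs0P _ _).1 fmax).
  have oa : `|rest (a *: g) / a| < eps.
    by near: a; apply: cvgr0_norm_lt => //; exact: rest0.
  have fEa : (f (x + a *: g) - f x)%:E =
      (inf_max_affine E (a *: g) + (rest (a *: g))%:E)%E.
    by near: a; exact: cvg0 fE.
  have : (inf_max_affine E (a *: g) < (a * eps)%:E)%E.
    (* By [fEa] the infimum plus a real is real, so it is a real [r]. Then [r + rest (a *: g) <= 0]
       and [rest (a *: g) > - eps * a] give [r < a * eps]. *)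
    case: (inf_max_affine E (a *: g)) fEa => [r [fr]|//|//].
    rewrite lte_fin; move: oa; rewrite ltr_norml ltr_pdivlMr// => /andP[oa _].
    by move: fa; rewrite -subr_le0 fr; lra.
  move=> /ereal_inf_lt[_ [C EC <-] CE]; exists C => // p Cp.
  have : ((0 + p (a *: g))%:E <= max_affine C (a *: g))%E.
    by apply: ereal_sup_ubound; exists (0, p).
  move=> /le_lt_trans/(_ CE); rewrite lte_fin add0r linearZ/=.
  by rewrite ltr_pM2l// => /ltW.
by move=> /filter_ex[].
Unshelve. all: by end_near. Qed.

Theorem proposition5p14 (R : realType) (X : completeNormedModType R)
    (Omega A : set X) (f : X -> R) (xs : X)
    (E : set (set (R^o * dual X))) :
  open Omega -> A `<=` Omega -> A !=set0 -> closed A -> convex_set A ->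
  A xs -> upper_coexhauster f xs E -> local_max_on f A xs ->
  (forall (eps : R) (g : X), 0 < eps -> feasible_dir xs A g ->
     exists2 C, E C & forall p : dual X, C (0, p) -> p g <= eps) /\
  (finite_set E ->
   forall g : X, closed_feasible_dir xs A g ->
     exists2 C, E C & forall p : dual X, C (0, p) -> p g <= 0).
Proof.
move=> _ _ _ _ cA _ coE fmax.
have approx eps g := @upper_coexhauster_feasible_dir R X A f xs E eps g cA coE fmax.
split=> // finE g gA; apply: contrapT => noC.
have pos C : E C -> exists2 p : dual X, C (0, p) & 0 < p g.
  move=> EC; apply: contrapT => noP; apply: noC; exists C => // p Cp.
  by rewrite leNgt; apply/negP => pg; apply: noP; exists p.
(* Any [e] below the positive value [p g] serves for one [C]; finitely many [C] share a common
   [e]. *)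
have : \forall e \near (0 : R)^'+,
    forall C, E C -> exists2 p : dual X, C (0, p) & e < p g.
  apply: near_finite_forall => // C /pos[p Cp pg].
  by near=> e; exists p => //; near: e; exact: nbhs_right_lt.
move=> /(filterI (nbhs_right_gt 0))/filter_ex[eps [/= eps0 epsE]].
(* By continuity of the functionals the strict bound at [g] persists on a neighbourhood, which meets
   the feasible directions because [g] is in their closure. *)
have /gA[h [hA hE]] : \forall h \near g,
    forall C, E C -> exists2 p : dual X, C (0, p) & eps < p h.
  apply: near_finite_forall => // C /epsE[p Cp pg].
  have : \forall h \near g, eps < p h.
    exact: (@dual_continuous R X p g _ (lt_nbhsr pg)).
  by apply: filterS => h ph; exists p.
have [C EC CE] := approx _ _ eps0 hA.
have [p Cp ph] := hE _ EC.
by have := lt_le_trans ph (CE _ Cp); rewrite ltxx.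
Unshelve. all: by end_near. Qed.
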